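(* Let $U\in\Sigma^*$ be the left frontier of a single-rooted minimal word $u$. The $\mathbf{C}^\infty$-words whose minimal part is $u$ are exactly the words $w\in\mathbf{C}^\infty$ with vertical representation $(U_0,V_0)$ such that $U_0$ is the label of a path in $G$ starting at the origin $\epsilon$ and ending at $U$, and $V_0$ is the label of a path in $G$ starting at the origin and ending at $\Gamma_s(U)$ if $w$ is single-rooted, or at $\Gamma_d(U)$ if $w$ is double-rooted.
   Context: Let $\Sigma=\{1,2\}$, $\Sigma_0=\{0,1,2\}$; $w[i]$ is the $(i+1)$-th letter of $w$, $\tilde w$ the reversal; juxtaposition denotes concatenation. For $w=x_1^{i_1}\cdots x_n^{i_n}$ over $\Sigma$ (maximal runs), $\Delta(w)=i_1\cdots i_n$. The derivative: $D(\epsilon)=\epsilon$, otherwise (when $\Delta(w)$ is over $\Sigma$) $D(w)$ is $\Delta(w)$ with its first symbol deleted if it is $1$ and its last symbol deleted if it is $1$. $\mathbf{C}^{\infty}$ is the set of words with $D^j(w)$ defined for all $j$. Height: least $k$ with $D^k(w)=\epsilon$; root: $D^{k-1}(w)$; single-/double-rooted if the root has length one/two. A primitive of $w$ is $w'$ with $D(w')=w$. $w\in\mathbf{C}^{\infty}$ of height $k>1$ is minimal if for each $0\le j\le k-2$, $D^j(w)$ is a primitive of $D^{j+1}(w)$ of minimal length among all its primitives; words of height $1$ are minimal. Left frontier of $w$ of height $k>0$: the word $\Psi(w)$ of length $k$ over $\Sigma_0$ with $\Psi(w)[0]=w[0]$ and for $0<i<k$, $\Psi(w)[i]=0$ if $D^i(w)[0]=2$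 and $D^{i-1}(w)[0]\ne D^{i-1}(w)[1]$, else $\Psi(w)[i]=D^i(w)[0]$; $\Psi(\epsilon)=\epsilon$. Right frontier: $\Psi(\tilde w)$. The vertical representation of $w$ is the pair $(\Psi(w),\Psi(\tilde w))$. Each $U\in\Sigma^*$ is the left frontier of a unique single-rooted minimal word and of a unique double-rooted minimal word; $\Gamma_s(U)$ (resp. $\Gamma_d(U)$) is the right frontier of the single-rooted (resp. double-rooted) minimal word with left frontier $U$ ($\Gamma_s(\epsilon)=\Gamma_d(\epsilon)=\epsilon$), and $\Theta=\Gamma_s\circ\Gamma_d$. Every $w\in\mathbf{C}^\infty$ of height $k>0$ contains a factor that is a single-rooted minimal word of height $k$; the minimal part of $w$ is the first (leftmost occurring) such factor. $G$ is the directed graph with vertex set $\Sigma^*$ (origin $\epsilon$) and, for each $U\in\Sigma^*$, three labeled edges: $U\to U1$ labeled $1$, $U\to U2$ labeled $2$, and $U\to\Theta(U)2$ labeled $0$. The label of a path is the concatenation of its edge labels. *)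

(* Defs.v *)
From mathcomp Require Import all_boot.
From Stdlib Require Import ClassicalEpsilon.

Set Implicit Arguments.
Unset Strict Implicit.
Unset Printing Implicit Defensive.

(* Words over Sigma = {1, 2}, over Sigma_0 = {0, 1, 2}, and the run-length
   sequences are all of type [seq nat]; membership in Sigma^* is [over_Sigma]. *)
Definition over_Sigma (w : seq nat) : bool := all (mem [:: 1; 2]) w.

(* The letter prepended to [w'] either lengthens its first run or opens a new one. *)
Fixpoint Delta (w : seq nat) : seq nat :=
  if w is x :: w' then
    if ohead w' == Some x then incr_nth (Delta w') 0 else 1 :: Delta w'
  else [::].

Definition drop_head1 (s : seq nat) : seq nat :=
  if s is 1 :: s' then s' else s.

(* A total function; the derivative proper is its restriction to
   [differentiable] words. The sequential deletion agrees with the simultaneous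
   one: when Delta w is the single letter 1, both give the empty word. *)
Definition D (w : seq nat) : seq nat :=
  rev (drop_head1 (rev (drop_head1 (Delta w)))).

Definition differentiable (w : seq nat) : bool := over_Sigma (Delta w).

Definition Cinf (w : seq nat) : Prop :=
  over_Sigma w /\ forall j, differentiable (iter j D w).

Lemma Delta_cons x w : exists n s, Delta (x :: w) = n.+1 :: s.
Proof.
elim: w x => [|y w IHw] x; first by exists 0, [::].
have [n [s E]] := IHw y; rewrite [Delta (x :: _)]/=.
case: ifP => _; last by exists 0, (Delta (y :: w)).
by rewrite -/(Delta (y :: w)) E; exists n.+1, s.
Qed.

Lemma sumn_Delta w : sumn (Delta w) = size w.
Proof.
elim: w => //= x w <-; case: w => [|y w] //=.
case: ifP => _; last by [].
have [n [s]] := Delta_cons y w; rewrite [Delta (y :: w)]/= => ->.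
by rewrite /= addSn.
Qed.

Lemma Delta_gt0 w : all (leq 1) (Delta w).
Proof.
elim: w => //= x w IHw; case: ifP => _ //=.
by case: (Delta w) IHw => //= n s /andP[_ ->].
Qed.

Lemma size_drop_head1 s : size (drop_head1 s) <= size s.
Proof. by case: s => [|[|[|n]] s] /=. Qed.

Lemma size_le_sumn s : all (leq 1) s -> size s <= sumn s.
Proof. by elim: s => //= n s IHs /andP[n1 /IHs]; apply: (leq_add n1). Qed.

Lemma size_D_lt w : w != [::] -> size (D w) < size w.
Proof.
case: w => [|x w] // _; rewrite -(sumn_Delta (x :: w)) /D size_rev.
apply: leq_ltn_trans (size_drop_head1 _) _; rewrite size_rev.
have := Delta_gt0 (x :: w); have [n [s ->]] := Delta_cons x w => /=.
by case: n => [|n] /size_le_sumn /=; rewrite !addSn ?add0n !ltnS // => /leq_trans;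
   apply; rewrite leq_addl.
Qed.

Lemma height_exists w : exists k, iter k D w == [::].
Proof.
have [m] := ubnP (size w); elim: m w => // m IHm w; rewrite ltnS => le_wm.
have [-> | w_n0] := eqVneq w [::]; first by exists 0.
have [k Ek] := IHm (D w) (leq_trans (size_D_lt w_n0) le_wm).
by exists k.+1; rewrite iterSr.
Qed.

Definition height (w : seq nat) : nat := ex_minn (height_exists w).

Definition root (w : seq nat) : seq nat := iter (height w).-1 D w.
Definition single_rooted (w : seq nat) : bool := size (root w) == 1.
Definition double_rooted (w : seq nat) : bool := size (root w) == 2.

(* [w'] is a primitive of [w] *)
Definition primitive (w w' : seq nat) : Prop :=
  [/\ over_Sigma w', differentiable w' & D w' = w].

Definition shortest_primitive (w w' : seq nat) : Prop :=
  primitive w w' /\ forall w'', primitive w w'' -> size w' <= size w''.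

(* The bound [j + 2 <= k] encodes [j <= k - 2]: it is vacuous for words of
   height 1, which are therefore all minimal. *)
Definition minimal (w : seq nat) : Prop :=
  [/\ Cinf w, 0 < height w &
      forall j, j + 2 <= height w ->
        shortest_primitive (iter j.+1 D w) (iter j D w)].

Definition frontier_letter (w : seq nat) (i : nat) : nat :=
  if i is i'.+1 then
    let p := iter i' D w in
    let q := iter i D w in
    if (nth 0 q 0 == 2) && (nth 0 p 0 != nth 0 p 1) then 0 else nth 0 q 0
  else nth 0 w 0.

Definition Psi (w : seq nat) : seq nat := mkseq (frontier_letter w) (height w).

Definition vertical_representation (w : seq nat) : seq nat * seq nat :=
  (Psi w, Psi (rev w)).

(* For nonempty [U] over Sigma the word chosen by [epsilon] exists and is unique. *)
Definition Gamma_s (U : seq nat) : seq nat :=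
  if U is [::] then [::] else
  Psi (rev (epsilon (inhabits [::])
    (fun u => [/\ minimal u, single_rooted u & Psi u = U]))).

Definition Gamma_d (U : seq nat) : seq nat :=
  if U is [::] then [::] else
  Psi (rev (epsilon (inhabits [::])
    (fun u => [/\ minimal u, double_rooted u & Psi u = U]))).

Definition Theta (U : seq nat) : seq nat := Gamma_s (Gamma_d U).

(* [u] occurs in [w] at position [i], as a single-rooted minimal word of the
   height of [w]. *)
Definition minimal_factor_at (w : seq nat) (i : nat) (u : seq nat) : Prop :=
  [/\ prefix u (drop i w), minimal u, single_rooted u & height u = height w].

Definition minimal_part (w u : seq nat) : Prop :=
  exists2 i, minimal_factor_at w i u &
    forall i' u', minimal_factor_at w i' u' -> i <= i'.

Inductive G_edge : seq nat -> nat -> seq nat -> Prop :=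
| G_edge1 U : over_Sigma U -> G_edge U 1 (rcons U 1)
| G_edge2 U : over_Sigma U -> G_edge U 2 (rcons U 2)
| G_edge0 U : over_Sigma U -> G_edge U 0 (rcons (Theta U) 2).

(* [G_path U l V]: [l] is the label of a path in G from [U] to [V] *)
Inductive G_path : seq nat -> seq nat -> seq nat -> Prop :=
| G_path_nil U : over_Sigma U -> G_path U [::] U
| G_path_cons U a W l V : G_edge U a W -> G_path W l V -> G_path U (a :: l) V.

(* Main.v *)
(* Prepending a letter to a word either leaves its derivative unchanged or prepends
   one letter to it. Hence every suffix of D^i(w) is the i-th derivative of a
   unique shortest suffix of w, whose left frontier has no 0 up to level i.
   Reading Psi(w) along G computes the left frontiers of these shortest suffixes
   for the whole word D^i(w), i = 0, 1, ...: a letter 1 or 2 keeps the suffix,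
   while a 0 means that D^i(w) starts with xyy, so that the suffix moves from the
   one above xyy to the one above yy, and this changes its left frontier by Theta.
   At the root, the suffix starts with the minimal part of w, which is the leftmost
   occurrence because lifting is monotone. The right frontier is the same statement
   for the reversed word, and minimal words are determined by their left frontier
   and the length of their root. *)

Require Import Defs.
From mathcomp Require Import all_boot zify.
From Stdlib Require Import ClassicalEpsilon.

Set Implicit Arguments.
Unset Strict Implicit.
Unset Printing Implicit Defensive.

(** * Run lengths and derivatives under reversal *)

Lemma DeltaE x w :
  Delta (x :: w) =
  if ohead w == Some x then incr_nth (Delta w) 0 else 1 :: Delta w.
Proof. by []. Qed.

Lemma Delta_rcons s x :
  Delta (rcons s x) =
  rev (if ohead (rev s) == Some x then incr_nth (rev (Delta s)) 0
       else 1 :: rev (Delta s)).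
Proof.
elim: s => [|y [|z s] IHs] //; first by rewrite /= eq_sym; case: ifP.
have E : ohead (rev (y :: z :: s)) = ohead (rev (z :: s)).
  rewrite rev_cons; case E: (rev (z :: s)) => [|a e] //.
  by move/(congr1 size): E; rewrite size_rev.
rewrite E rcons_cons DeltaE IHs (DeltaE y) rcons_cons /=.
rewrite -/(Delta (z :: s)).
have [n [d ->]] := Delta_cons z s; case/lastP: d => [|d a].
  by do 2 case: ifP => _; rewrite /rev /= ?addn1.
by do 2 case: ifP => _;
  rewrite /= ?rev_cons ?rev_rcons /= ?rev_rcons ?rev_cons ?rev_rcons ?revK /=.
Qed.

Lemma Delta_rev w : Delta (rev w) = rev (Delta w).
Proof.
elim: w => // x w IHw; rewrite rev_cons Delta_rcons revK IHw revK.
by rewrite /=; case: ifP.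
Qed.

Lemma D_rev w : D (rev w) = rev (D w).
Proof.
rewrite /D Delta_rev revK; move: (Delta w) => s.
case: s => [|a s] //; case/lastP: s => [|s b].
  by case: a => [|[|a]].
rewrite rev_cons rev_rcons rcons_cons.
by case: a => [|[|a]]; case: b => [|[|b]];
  rewrite /= ?rev_cons ?rev_rcons /= ?rev_cons ?rev_rcons ?revK ?rcons_cons.
Qed.

Lemma iter_D_rev i w : iter i D (rev w) = rev (iter i D w).
Proof. by elim: i => //= i ->; rewrite D_rev. Qed.

Lemma iter_D_nil i : iter i D [::] = [::].
Proof. by elim: i => //= i ->. Qed.

Lemma differentiable_rev w : differentiable (rev w) = differentiable w.
Proof. by rewrite /differentiable /over_Sigma Delta_rev all_rev. Qed.

Lemma over_Sigma_D w : differentiable w -> over_Sigma (D w).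
Proof.
have H s : over_Sigma s -> over_Sigma (drop_head1 s).
  by case: s => [|[|[|n]] s] //= /andP[].
rewrite /D /over_Sigma => dw; rewrite all_rev; apply: (H).
by rewrite /over_Sigma all_rev; apply: (H).
Qed.

Lemma CinfE w : Cinf w <-> [/\ over_Sigma w, differentiable w & Cinf (D w)].
Proof.
split=> [[ow dw]|[ow dw [oDw dDw]]].
  split=> //; first exact: (dw 0).
  by split=> [|j]; [exact/over_Sigma_D/(dw 0) | rewrite -iterSr; exact: dw].
by split=> // -[|j] //; rewrite iterSr.
Qed.

Lemma Cinf_iter i w : Cinf w -> Cinf (iter i D w).
Proof. by move=> cw; elim: i => //= i /CinfE[]. Qed.

Lemma Cinf_rev w : Cinf w -> Cinf (rev w).
Proof.
case=> ow dw; split; first by rewrite /over_Sigma all_rev.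
by move=> j; rewrite iter_D_rev differentiable_rev.
Qed.

(** * Derivatives of factors *)

(** Outside the degenerate case, a letter equal to the first of [t] turns a run of length 1 into a
    2. A different letter opens a run of length 1, itself deleted: it protects a first run of length
    1 of [t] from deletion, and changes nothing before a run of length 2. *)
Variant D_cons_spec (x : nat) (t : seq nat) : seq nat -> Prop :=
| D_cons_nil : D t = [::] -> D_cons_spec x t [::]
| D_cons_double : ohead t = Some x -> D_cons_spec x t (2 :: D t)
| D_cons_single : ohead t != Some x -> D_cons_spec x t (1 :: D t)
| D_cons_loose : ohead t != Some x -> D t = 2 :: D (behead t) ->
    D_cons_spec x t (D t).

Lemma D_consP x t : differentiable (x :: t) -> D_cons_spec x t (D (x :: t)).
Proof.
(* Deletion at the right end, which commutes with consing unless the consed 1 is also the last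
   letter. *)
pose rdrop s := rev (drop_head1 (rev s)).
have r2 d : rdrop (2 :: d) = 2 :: rdrop d.
  rewrite /rdrop rev_cons; case: (rev d) => [|[|[|n]] e] //=; by rewrite -?rcons_cons rev_rcons.
have r1 a d : rdrop (1 :: a :: d) = 1 :: rdrop (a :: d).
  rewrite /rdrop rev_cons; case E: (rev (a :: d)) => [|[|[|n]] e] //=; last 3 first.
  - by rewrite -?rcons_cons rev_rcons.
  - by rewrite -?rcons_cons rev_rcons.
  - by rewrite -?rcons_cons rev_rcons.
  by move/(congr1 size): E; rewrite size_rev.
have DE w : D w = rdrop (drop_head1 (Delta w)) by [].
case: t => [|y t]; first by move=> _; exact: D_cons_nil.
have [n [d Ed]] := Delta_cons y t.
rewrite /differentiable [Delta (x :: _)]/= -/(Delta (y :: t)).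
have [[<-]|nyx] := @eqP _ (Some y) (Some x).
  rewrite Ed /= inE => /andP[n2 _].
  have ->: D (y :: y :: t) = 2 :: D (y :: t).
    rewrite !DE [Delta (y :: y :: _)]/= eqxx -/(Delta (y :: t)) Ed.
    by case: n n2 Ed => [|[|n]] // _ _; rewrite -r2.
  exact: D_cons_double.
have nyx' : ohead (y :: t) != Some x by apply/eqP.
have Dx : Delta (x :: y :: t) = 1 :: Delta (y :: t).
  by rewrite [Delta (x :: _)]/= (negPf (introN eqP nyx)).
rewrite Ed DE Dx Ed => /andP[_ /andP[n2 _]].
case: n n2 Ed => [|[|n]] // _ Ed.
  have Dy : D (y :: t) = rdrop d by rewrite DE Ed.
  case: d Ed Dy => [|a d] Ed Dy /=; first by apply: D_cons_nil; rewrite Dy.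
  by rewrite r1 -Dy; apply: D_cons_single.
have Dy : D (y :: t) = rdrop (2 :: d) by rewrite DE Ed.
rewrite [drop_head1 _]/= -Dy; apply: D_cons_loose => //; rewrite Dy r2; congr cons.
rewrite [behead _]/= DE; move: Ed; rewrite [Delta (y :: t)]/=.
case: ifP => _ [].
  by case: (Delta t) => [|m e] //= [->] ->.
by [].
Qed.

Lemma differentiable_behead w : differentiable w -> differentiable (behead w).
Proof.
case: w => [|x [|y t]] //.
rewrite /differentiable /over_Sigma DeltaE; have [n [d ->]] := Delta_cons y t.
by case: ifP => _ /= /andP[]; case: n => [|[|n]].
Qed.

Lemma cat_injr (T : Type) (s s1 s2 : seq T) : s1 ++ s = s2 ++ s -> s1 = s2.
Proof.
move=> e; have := congr1 size e; rewrite !size_cat => /addIn es.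
by have := congr1 (take (size s1)) e; rewrite take_size_cat // es take_size_cat.
Qed.

Lemma D_cat A s : differentiable (A ++ s) ->
  differentiable s /\ exists X, D (A ++ s) = X ++ D s.
Proof.
elim: A => [|x A IHA] dAs; first by split=> //; exists [::].
have [ds [X E]] := IHA (differentiable_behead dAs).
split=> //; rewrite [_ ++ _]/= in dAs *; case: (D_consP dAs) => [E0|_|_|_ _].
- by exists [::]; move: E; rewrite E0; case: X.
- by exists (2 :: X); rewrite E.
- by exists (1 :: X); rewrite E.
- by exists X.
Qed.

Lemma D_catr s B : differentiable (s ++ B) ->
  differentiable s /\ exists Y, D (s ++ B) = D s ++ Y.
Proof.
rewrite -differentiable_rev rev_cat => /D_cat[].
rewrite differentiable_rev => ds [X E]; split=> //; exists (rev X).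
by rewrite -[LHS]revK -D_rev rev_cat E rev_cat D_rev !revK.
Qed.

Lemma iter_D_cat i A s : Cinf (A ++ s) ->
  exists X, iter i D (A ++ s) = X ++ iter i D s.
Proof.
case=> _ dAs; elim: i => [|i [X E]]; first by exists A.
by move: (dAs i); rewrite !iterS E => /D_cat[].
Qed.

Lemma iter_D_catr i s B : Cinf (s ++ B) ->
  exists Y, iter i D (s ++ B) = iter i D s ++ Y.
Proof.
case=> _ dAs; elim: i => [|i [X E]]; first by exists B.
by move: (dAs i); rewrite !iterS E => /D_catr[].
Qed.

Lemma Cinf_cat A s : Cinf (A ++ s) -> Cinf s.
Proof.
move=> cAs; have [oAs dAs] := cAs; split=> [|i].
  by move: oAs; rewrite /over_Sigma all_cat => /andP[].
by have [X E] := iter_D_cat i cAs; move: (dAs i); rewrite E => /D_cat[].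
Qed.

Lemma Cinf_catr s B : Cinf (s ++ B) -> Cinf s.
Proof. by move/Cinf_rev; rewrite rev_cat => /Cinf_cat/Cinf_rev; rewrite revK. Qed.

(* Whether prepending a letter lengthens the derivative is decided by the
   following letters alone as soon as their derivative is nonempty. *)
Lemma D_modular A m B X : differentiable (A ++ m ++ B) -> D m != [::] ->
  D (A ++ m) = X ++ D m -> D (A ++ m ++ B) = X ++ D (m ++ B).
Proof.
move=> dw m0; elim: A X dw => [|x A IHA] X dw.
  by move/(cat_injr (s1 := [::])) <-.
have [dAm [X' E']] : differentiable (A ++ m) /\ exists X', D (A ++ m) = X' ++ D m.
  move: (differentiable_behead dw); rewrite /= catA => /D_catr[dAm _].
  by split=> //; case: (D_cat dAm).
have E2 := IHA _ (differentiable_behead dw) E'.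
have [d1 [Y]] : differentiable (x :: A ++ m) /\
    exists Y, D (x :: A ++ m ++ B) = D (x :: A ++ m) ++ Y.
  by have := @D_catr (x :: A ++ m) B; rewrite cat_cons -catA; apply.
have Eh : ohead (A ++ m ++ B) = ohead (A ++ m).
  by case: A {IHA dw dAm E' E2 d1} => //; case: m m0.
(* Excludes the degenerate case of [D_consP], the only one that letters further right could
   alter. *)
have p0 : D (A ++ m) != [::] by rewrite E'; case: X' {E' E2}; case: (D m) m0.
rewrite !cat_cons; case: (D_consP d1) => [e0|e1|e1|e1 e2].
- by rewrite e0 in p0.
- case: (D_consP dw) => [|_|//|e _] //; last by rewrite Eh e1 eqxx in e.
  by rewrite E' E2 -!cat_cons => _ /cat_injr <-.
- case: (D_consP dw) => [|//|_|_ ->] //.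
  by rewrite E' E2 -!cat_cons => _ /cat_injr <-.
- rewrite e2; case: (D_consP dw) => [|e|//|_ _] //; first by rewrite -Eh e eqxx in e1.
  by rewrite -e2 E' E2 => _ /cat_injr <-.
Qed.

Lemma iter_D_modular i A m B X : Cinf (A ++ m ++ B) -> iter i D m != [::] ->
  iter i D (A ++ m) = X ++ iter i D m ->
  iter i D (A ++ m ++ B) = X ++ iter i D (m ++ B).
Proof.
move=> cw; have cm := Cinf_catr (Cinf_cat cw).
have cAm : Cinf (A ++ m) by move: cw; rewrite catA => /Cinf_catr.
elim: i X => [|i IHi] X m0 E; first by rewrite (cat_injr E).
have mi0 : iter i D m != [::] by apply: contra_neq m0; rewrite iterS => ->.
have [Xi Ei] := iter_D_cat i cAm.
have [Y EY] := iter_D_catr i (Cinf_cat cw).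
have Ew := IHi _ mi0 Ei; rewrite !iterS Ew EY.
apply: D_modular => //; last by rewrite -Ei -!iterS.
by rewrite -EY -Ew; case: cw.
Qed.

(** * Tightness and the uniqueness of shortest suffixes *)

(* When [D w] is nonempty, this says that [Delta w] does not start with 1, 2. *)
Definition tight w := D (behead w) != D w.

Lemma not_tightP w : differentiable w -> D w != [::] -> ~~ tight w ->
  [/\ D w = 2 :: D (behead (behead w)), ohead (behead w) != ohead w,
      D (behead w) = D w & tight (behead w)].
Proof.
case: w => [|x t] // dw; rewrite negbK [behead _]/=.
have neq (a : nat) s : s <> a :: s by move/(congr1 size) => /=; lia.
case: (D_consP dw) => [|_|_|e1 e2] // _ /eqP; try by move/neq.
split=> //; rewrite /tight e2; apply/eqP; exact: neq.
Qed.

Lemma tight_behead w : differentiable w -> tight w ->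
  exists c, D w = c :: D (behead w).
Proof.
case: w => [|x t] // dw; rewrite /tight [behead _]/=.
case: (D_consP dw) => [|_|_|_ _]; last by rewrite eqxx.
- by move=> ->.
- by exists 2.
- by exists 1.
Qed.

(** The bridge to frontiers: the negated test is the one under which [frontier_letter] writes a
    0. *)
Lemma tightE w : differentiable w -> D w != [::] ->
  tight w = ~~ ((nth 0 (D w) 0 == 2) && (nth 0 w 0 != nth 0 w 1)).
Proof.
case: w => [|x t] // dw; rewrite /tight [behead _]/=.
have neq (a : nat) s : s != a :: s by apply/eqP => /(congr1 size) /=; lia.
case: (D_consP dw) => [|e|_|e1 e2] // _; rewrite ?neq //.
  by case: t e {dw} => //= y t [->]; rewrite eqxx.
rewrite eqxx e2; case: t e1 e2 {dw} => //= y t e1 _.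
by rewrite eq_sym; apply/esym/negbF; apply: contraNneq e1 => ->.
Qed.

Lemma D_short w : size w <= 1 -> D w = [::].
Proof. by case: w => [|x [|y w]]. Qed.

Lemma tight_catr m B : differentiable (m ++ B) -> D m != [::] ->
  tight (m ++ B) = tight m.
Proof.
move=> dw m0; have [dm [Y E]] := D_catr dw.
have sm : 1 < size m by rewrite ltnNge; apply: contraNN m0 => /D_short->.
rewrite !tightE // E; last by case: (D m) m0.
case: (D m) m0 => // c d _; by case: m sm {dm E dw} => [|x [|y m]].
Qed.

(* Left half of minimality at the first [i] levels, i.e. no 0 among the letters
   1, ..., [i] of the left frontier. *)
Definition ltight i w := forall j, j < i -> tight (iter j D w).

Lemma ltightS i w : ltight i.+1 w <-> ltight i w /\ tight (iter i D w).
Proof.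
split=> [tw|[tw ti] j]; first by split=> [j ji|]; apply: tw => //; apply: ltnW.
by rewrite ltnS leq_eqVlt => /predU1P[-> //|]; apply: tw.
Qed.

Lemma ltightSl i w : ltight i.+1 w <-> tight w /\ ltight i (D w).
Proof.
split=> [tw|[tw ti] [|j] //]; last by rewrite iterSr; exact: ti.
by split=> [|j ji]; [exact: (tw 0) | rewrite -iterSr; exact: tw].
Qed.

Lemma iter_D_neq0 j i w : j <= i -> iter i D w != [::] -> iter j D w != [::].
Proof.
by move=> ji; apply: contra_neq => e; rewrite -(subnK ji) iterD e iter_D_nil.
Qed.

Lemma ltight_catr i m B : Cinf (m ++ B) -> iter i D m != [::] ->
  ltight i m <-> ltight i (m ++ B).
Proof.
move=> cw m0.
have H j : j < i -> tight (iter j D (m ++ B)) = tight (iter j D m).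
  move=> ji; have [Y E] := iter_D_catr j cw; rewrite E tight_catr //.
    by rewrite -E; case: cw.
  by rewrite -iterS; apply: iter_D_neq0 m0.
by split=> tm j ji; have := tm _ ji; rewrite H.
Qed.

(** At a tight level, removing the first letter already costs the derivative one letter, so a
    nonempty prefix leaves a trace at every level. *)
Lemma iter_D_proper i A s : Cinf (A ++ s) -> A != [::] -> ltight i (A ++ s) ->
  exists2 X, X != [::] & iter i D (A ++ s) = X ++ iter i D s.
Proof.
move=> cw A0; elim: i => [|i IHi]; first by exists A.
case/ltightS => tw ti; have [[|c X] // _ E] := IHi tw.
have dw : differentiable (iter i D (A ++ s)) by case: cw.
have [a Ea] := tight_behead dw ti; rewrite E [behead _]/= in Ea dw *.
have [_ [Z EZ]] := D_cat (differentiable_behead dw).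
by exists (a :: Z); rewrite // !iterS E Ea EZ.
Qed.

Lemma eq_cat_suffix (T : Type) (A1 A2 s1 s2 : seq T) :
  A1 ++ s1 = A2 ++ s2 -> size s2 <= size s1 -> exists E, s1 = E ++ s2.
Proof.
move=> e le; exists (drop (size A1) A2).
have sA : size A1 <= size A2.
  by have := congr1 size e; rewrite !size_cat; lia.
have := congr1 (drop (size A1)) e; rewrite drop_size_cat // drop_cat => ->.
by case: ltngtP sA => // -> _; rewrite subnn drop0 drop_size.
Qed.

(** Monotonicity of lifting: if [s1] were longer, it would be [s2] with a nonempty prefix, and that
    prefix would survive [i] derivatives by [iter_D_proper]. *)
Lemma ltight_size i A1 A2 s1 s2 : A1 ++ s1 = A2 ++ s2 -> Cinf (A1 ++ s1) ->
  ltight i s1 -> size (iter i D s1) <= size (iter i D s2) -> size s1 <= size s2.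
Proof.
move=> e cw ts; apply: contraTT; rewrite -!ltnNge => lt.
have [E Es] := eq_cat_suffix e (ltnW lt).
have E0 : E != [::] by apply: contraTneq lt => e0; rewrite Es e0 ltnn.
move: ts (Cinf_cat cw); rewrite Es => ts cs.
have [X X0 ->] := iter_D_proper cs E0 ts.
by rewrite size_cat; case: X X0 => //= *; lia.
Qed.

Lemma ltight_uniq i A1 A2 s1 s2 : A1 ++ s1 = A2 ++ s2 -> Cinf (A1 ++ s1) ->
  ltight i s1 -> ltight i s2 -> size (iter i D s1) = size (iter i D s2) -> s1 = s2.
Proof.
move=> e cw t1 t2 es.
have /eqP es12 : size s1 == size s2.
  have le1 := @ltight_size i _ _ _ _ e; have le2 := @ltight_size i _ _ _ _ (esym e).
  by rewrite eqn_leq le1 ?es // le2 ?es // -e.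
have [E Es] := eq_cat_suffix e (eq_leq (esym es12)).
by move: es12; rewrite Es size_cat; case: E {Es} => //= ? ?; lia.
Qed.

(** * Lifting factors of a derivative *)

(** Strip letters from the left: each one removes one letter of the derivative if the word is tight
    and none otherwise, so no suffix [v] is skipped. Stop at the first tight word above [v]. *)
Lemma lift_suffix1 w L v : differentiable w -> D w = L ++ v -> v != [::] ->
  exists A s, [/\ w = A ++ s, D s = v & tight s].
Proof.
elim: w L => [|x t IHt] L dw E v0; first by case: L v v0 E => [|? ?] [].
have [tw|ntw] := boolP (tight (x :: t)).
  have [c Ec] := tight_behead dw tw.
  case: L E => [|a L] E; first by exists [::], (x :: t).
  have Et : D t = L ++ v by move: E; rewrite Ec => -[].
  have [A [s [-> <- ts]]] := IHt L (differentiable_behead dw) Et v0.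
  by exists (x :: A), s.
have Dt := eqP (negbNE ntw).
have [A [s [-> <- ts]]] := IHt L (differentiable_behead dw) (etrans Dt E) v0.
by exists (x :: A), s.
Qed.

Lemma lift_suffix i w L v : Cinf w -> iter i D w = L ++ v -> v != [::] ->
  exists A s, [/\ w = A ++ s, iter i D s = v & ltight i s].
Proof.
elim: i w L => [|i IHi] w L cw E v0; first by exists L, v.
have [_ dw cDw] := iffLR (CinfE w) cw.
have [A [s [EA Es ts]]] := IHi (D w) L cDw (etrans (esym (iterSr _ _ _)) E) v0.
have s0 : s != [::] by apply: contra_neq v0 => s0; rewrite -Es s0 iter_D_nil.
have [A' [s' [-> Es' ts']]] := lift_suffix1 dw EA s0.
by exists A', s'; split=> //; [rewrite iterSr Es' | apply/ltightSl; rewrite Es'].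
Qed.

Lemma lift_prefix i w v R : Cinf w -> iter i D w = v ++ R -> v != [::] ->
  exists s B, [/\ w = s ++ B, iter i D s = v & ltight i (rev s)].
Proof.
move=> cw E v0.
have rv0 : rev v != [::] by rewrite -size_eq0 size_rev size_eq0.
have := @lift_suffix i (rev w) (rev R) (rev v) (Cinf_rev cw) _ rv0.
rewrite iter_D_rev E rev_cat => /(_ erefl)[A [s [e Es ts]]].
exists (rev s), (rev A); split; rewrite ?revK //.
  by rewrite -rev_cat -e revK.
by rewrite iter_D_rev Es revK.
Qed.

(** * Heights *)

Lemma heightP i w : reflect (iter i D w != [::]) (i < height w).
Proof.
rewrite /height; case: ex_minnP => k /eqP k0 kmin; apply: (iffP idP) => [ik|].
  by apply: contraTneq ik => e; rewrite -leqNgt kmin ?e.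
by apply: contraNltn => ki; rewrite -(subnK ki) iterD k0 iter_D_nil.
Qed.

Lemma height_eq i w : iter i D w != [::] -> iter i.+1 D w = [::] -> height w = i.+1.
Proof.
move=> /heightP lt e; apply/eqP; rewrite eqn_leq lt andbT leqNgt.
by apply/negP => /heightP; rewrite e.
Qed.

Lemma iter_height i w : height w = i.+1 ->
  [/\ iter i D w != [::], iter i.+1 D w = [::] & Defs.root w = iter i D w].
Proof.
move=> h; rewrite /Defs.root h; split=> //; first by apply/heightP; rewrite h.
by apply/eqP; apply: contraFT (ltnn i.+1) => /heightP; rewrite h.
Qed.

Lemma height_rev w : height (rev w) = height w.
Proof.
have le v : height (rev v) <= height v.
  rewrite leqNgt; apply/negP => /heightP; rewrite iter_D_rev.
  by rewrite -size_eq0 size_rev size_eq0 => /heightP; rewrite ltnn.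
by apply/eqP; rewrite eqn_leq le -{1}[w]revK le.
Qed.

(** * Shortest primitives and minimal words *)

Lemma Delta_D_nil w : D w = [::] -> Delta w = nseq (size w) 1.
Proof.
have dh0 t : drop_head1 t = [::] -> t = [::] \/ t = [:: 1].
  by case: t => [|[|[|n]] [|b t]] //=; auto.
rewrite -(sumn_Delta w) /D; move: (Delta w) => s.
move/(congr1 rev); rewrite revK => /dh0.
case=> /(congr1 rev); rewrite revK; first by move/dh0=> [] ->.
by case: s => [|[|[|n]] s] //= ->.
Qed.

Lemma over_Sigma_cons x t :
  over_Sigma (x :: t) = ((x == 1) || (x == 2)) && over_Sigma t.
Proof. by rewrite /over_Sigma /= !inE. Qed.

Lemma Delta_inj w1 w2 : over_Sigma w1 -> over_Sigma w2 ->
  Delta w1 = Delta w2 -> nth 0 w1 0 = nth 0 w2 0 -> w1 = w2.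
Proof.
elim: w1 w2 => [|x t1 IH] [|y t2] //.
- by move=> _ _; have [n [s ->]] := Delta_cons y t2.
- by move=> _ _; have [n [s ->]] := Delta_cons x t1.
rewrite !over_Sigma_cons => /andP[xS o1] /andP[_ o2] + /= xy.
rewrite -{}xy {y} !DeltaE.
case: t1 t2 IH o1 o2 => [|a t1] [|b t2] IH o1 o2 //.
- by have [n [s ->]] := Delta_cons b t2; case: ifP.
- by have [n [s ->]] := Delta_cons a t1; case: ifP.
(* Run lengths are positive, so a leading 1 tells that [x] opened a new run. Hence both next letters
   equal [x], or both are the other letter of the alphabet. *)
move=> e; congr cons; apply: IH => //; move: e.
  have [n1 [s1 ->]] := Delta_cons a t1; have [n2 [s2 ->]] := Delta_cons b t2.
  by case: ifP => _; case: ifP => _ // [] -> ->.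
move: o1 o2; rewrite !over_Sigma_cons => /andP[aS _] /andP[bS _].
have [n1 [s1 ->]] := Delta_cons a t1; have [n2 [s2 ->]] := Delta_cons b t2.
have SomeE (c d : nat) : (Some c == Some d) = (c == d) by [].
by rewrite !SomeE /=; do 2 case: eqP => ? //=; lia.
Qed.

(** Undoes [drop_head1] on tight words: a surviving leading 1 must have had a deleted 1 before it,
    while a deleted 1 before a 2 would contradict tightness. *)
Definition pad s := if nth 0 s 0 == 1 then 1 :: s else s.

Lemma tight_pad w : differentiable w -> D w != [::] -> tight w ->
  Delta w = pad (drop_head1 (Delta w)).
Proof.
case: w => [|x t] // dw; move: (dw); rewrite /differentiable /tight /D DeltaE.
rewrite [behead _]/=; case: t dw => [|y t] dw //.
have [n [s ->]] := Delta_cons y t; case: ifP => _ /=.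
  by case: n.
case: n => [|[|n]] //= _ _; by rewrite eqxx.
Qed.

Lemma tight_Delta w : differentiable w -> D w != [::] -> tight w -> tight (rev w) ->
  Delta w = pad (rev (pad (rev (D w)))).
Proof.
move=> dw w0 tw trw.
have := tight_pad dw w0 tw.
have := @tight_pad (rev w); rewrite differentiable_rev D_rev Delta_rev.
rewrite -size_eq0 size_rev size_eq0 => /(_ dw w0 trw).
move: w0; rewrite /D revK; move: (Delta w) => s s0 er el.
(* Tightness of [rev w] speaks of the uncut run lengths. It transfers to those already cut on the
   left because [D w] is nonempty, so that the two cuts do not meet. *)
suff <- : rev (drop_head1 s) = pad (drop_head1 (rev (drop_head1 s))) by rewrite revK.
case: s s0 er el => [|[|[|n]] s] // s0 er _; move: s0 er.
rewrite rev_cons [drop_head1 _]/=; case: (rev s) => [|[|[|b]] [|c e]] //= _.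
by rewrite /pad /=; case: eqP => [->|c1 [/esym/c1]].
Qed.

(** If an end is not tight, dropping its letter gives a shorter primitive. Conversely, any primitive
    contains a factor tight at both ends with the same derivative, and by [tight_Delta] this factor
    has the run lengths of [w], hence its size. *)
Lemma shortest_primitiveP w : over_Sigma w -> differentiable w -> D w != [::] ->
  shortest_primitive (D w) w <-> tight w /\ tight (rev w).
Proof.
move=> ow dw w0.
have wn : w != [::] by apply: contra_neq w0 => ->.
have obehead v : over_Sigma v -> over_Sigma (behead v).
  by case: v => //= ? ? /andP[].
split=> [[_ wmin]|[tw trw]].
  split; apply: contraT => /negbNE/eqP e.
    have := wmin (behead w) (And3 (obehead _ ow) (differentiable_behead dw) e).
    by rewrite size_behead; case: w wn {ow dw w0 wmin e} => //= *; lia.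
  have := wmin (rev (behead (rev w))); rewrite size_rev size_behead size_rev.
  case: w wn ow dw w0 wmin e => //= a w _ ow dw w0 wmin e; rewrite ltnn; apply.
  split.
  - by rewrite /over_Sigma all_rev; apply: obehead; rewrite /over_Sigma all_rev.
  - by rewrite differentiable_rev; apply: differentiable_behead; rewrite differentiable_rev.
  - by rewrite D_rev e D_rev revK.
split=> // w' [ow' dw' e].
have [A [s [Ew' es ts]]] := lift_suffix1 dw' (e : D w' = [::] ++ D w) w0.
have ds : differentiable s by move: dw'; rewrite Ew' => /D_cat[].
have es' : D (rev s) = [::] ++ rev (D w) by rewrite D_rev es.
have rw0 : rev (D w) != [::] by rewrite -size_eq0 size_rev size_eq0.
have [|A2 [s2 [Es es2 ts2]]] := lift_suffix1 _ es' rw0.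
  by rewrite differentiable_rev.
have Es' : s = rev s2 ++ rev A2 by rewrite -rev_cat -Es revK.
have eD : D (rev s2) = D w by rewrite D_rev es2 revK.
have d2 : differentiable (rev s2) by move: ds; rewrite Es' => /D_catr[].
have t2 : tight (rev s2) by rewrite -(@tight_catr _ (rev A2)) -?Es' ?eD.
have := tight_Delta d2; rewrite eD revK => /(_ w0 t2 ts2).
rewrite -(tight_Delta dw w0 tw trw) => /(congr1 sumn); rewrite !sumn_Delta => <-.
by rewrite Ew' size_cat Es' size_cat addnCA leq_addr.
Qed.

Lemma minimalP i u : Cinf u -> height u = i.+1 ->
  minimal u <-> ltight i u /\ ltight i (rev u).
Proof.
move=> cu hu; have [ui0 _ _] := iter_height hu.
have H j : j < i ->
    shortest_primitive (iter j.+1 D u) (iter j D u) <->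
    tight (iter j D u) /\ tight (iter j D (rev u)).
  move=> ji; rewrite iter_D_rev iterS.
  have [oj dj _] := iffLR (CinfE _) (Cinf_iter j cu).
  by apply: shortest_primitiveP => //; rewrite -iterS; exact: iter_D_neq0 ui0.
split=> [[_ _ umin]|[t1 t2]].
  have H' j (ji : j < i) : tight (iter j D u) /\ tight (iter j D (rev u)).
    by apply/(H j ji)/umin; rewrite hu addn2.
  by split=> j /H'[].
by split; rewrite ?hu // => j; rewrite addn2 => ji; apply/H; auto.
Qed.

(** Rebuild the word from its root, whose runs all have length 1: at each level [tight_Delta] gives
    the run lengths, and the first letter does the rest. *)
Lemma ltight_first_letters_inj i u1 u2 : Cinf u1 -> Cinf u2 ->
  ltight i u1 -> ltight i (rev u1) -> ltight i u2 -> ltight i (rev u2) ->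
  height u1 = i.+1 -> height u2 = i.+1 -> size (Defs.root u1) = size (Defs.root u2) ->
  (forall j, j <= i -> nth 0 (iter j D u1) 0 = nth 0 (iter j D u2) 0) -> u1 = u2.
Proof.
move=> c1 c2 t1 r1 t2 r2 /iter_height[n1 z1 ->] /iter_height[n2 z2 ->].
elim: i u1 u2 c1 c2 t1 r1 t2 r2 n1 n2 z1 z2 => [|i IHi] u1 u2 c1 c2.
  move=> _ _ _ _ _ _ /= /Delta_D_nil e1 /Delta_D_nil e2 es h.
  by apply: Delta_inj (h 0 isT); rewrite ?e1 ?e2 ?es //; [case: c1 | case: c2].
have [o1 d1 cD1] := iffLR (CinfE u1) c1; have [o2 d2 cD2] := iffLR (CinfE u2) c2.
move=> /ltightSl[t1 t1'] /ltightSl[r1 r1'] /ltightSl[t2 t2'] /ltightSl[r2 r2'].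
move=> n1 n2 z1 z2 es h.
rewrite iterSr in n1; rewrite iterSr in n2; rewrite iterSr in z1; rewrite iterSr in z2.
have eD : D u1 = D u2.
  apply: IHi => //; rewrite -?D_rev // -?iterSr // => j ji.
  by rewrite -!iterSr; exact: h.
have n1' : D u1 != [::] by exact: (@iter_D_neq0 0 i (D u1)).
apply: Delta_inj (h 0 isT) => //.
by rewrite !tight_Delta -?eD.
Qed.

(** * Frontiers of minimal words *)

Lemma frontier_letterS i w : Cinf w -> iter i.+1 D w != [::] ->
  frontier_letter w i.+1 =
  if tight (iter i D w) then nth 0 (iter i.+1 D w) 0 else 0.
Proof.
move=> cw w0; rewrite tightE ?if_neg //; by case: cw.
Qed.

Lemma frontier_letter_tight i j w : Cinf w -> iter i D w != [::] -> ltight i w ->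
  j <= i -> frontier_letter w j = nth 0 (iter j D w) 0.
Proof.
move=> cw w0 tw; case: j => // j ji.
by rewrite frontier_letterS ?tw //; apply: iter_D_neq0 w0.
Qed.

Lemma frontier_letter_catr i j m B : Cinf (m ++ B) -> iter i D m != [::] ->
  j <= i -> frontier_letter (m ++ B) j = frontier_letter m j.
Proof.
move=> cw m0; case: j => [_|j ji]; first by case: m m0 cw => //; rewrite iter_D_nil.
have [Y EY] := iter_D_catr j cw; have [Y' EY'] := iter_D_catr j.+1 cw.
have mj : iter j.+1 D m != [::] by apply: iter_D_neq0 m0.
rewrite !frontier_letterS ?EY' //; last 2 first.
- exact: Cinf_catr cw.
- by case: (iter j.+1 D m) mj.
rewrite EY tight_catr // -?EY; last by case: cw.
by case: (iter j.+1 D m) mj.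
Qed.

Lemma minimal_Psi_inj u1 u2 : minimal u1 -> minimal u2 ->
  size (Defs.root u1) = size (Defs.root u2) -> Psi u1 = Psi u2 -> u1 = u2.
Proof.
move=> m1 m2 er eP; have [c1 h1 _] := m1; have [c2 _ _] := m2.
have eh : height u2 = height u1.
  by move/(congr1 size): eP; rewrite !size_mkseq.
case E: (height u1) h1 => [//|i] _; rewrite E in eh.
have [t1 r1] := iffLR (minimalP c1 E) m1; have [t2 r2] := iffLR (minimalP c2 eh) m2.
have [n1 _ _] := iter_height E; have [n2 _ _] := iter_height eh.
apply: (@ltight_first_letters_inj i) => // j ji.
rewrite -(frontier_letter_tight c1 n1 t1) // -(frontier_letter_tight c2 n2 t2) //.
by have := congr1 (fun s => nth 0 s j) eP; rewrite !nth_mkseq ?E ?eh.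
Qed.

(** Since [u] witnesses the predicate given to [epsilon], the chosen word satisfies it, and
    [minimal_Psi_inj] identifies it with [u]. *)
Lemma Gamma_s_Psi u : minimal u -> single_rooted u -> Gamma_s (Psi u) = Psi (rev u).
Proof.
move=> mu su; have : Psi u != [::].
  by rewrite -size_eq0 size_mkseq; case: mu => _; case: height.
rewrite /Gamma_s; case E: (Psi u) => [//|a s] _; rewrite -E.
have [mv sv ev] := epsilon_spec (inhabits [::])
  (fun v => [/\ minimal v, single_rooted v & Psi v = Psi u]) (ex_intro _ u (And3 mu su erefl)).
by congr (Psi (rev _)); apply: minimal_Psi_inj ev => //; rewrite (eqP su) (eqP sv).
Qed.

Lemma Gamma_d_Psi u : minimal u -> double_rooted u -> Gamma_d (Psi u) = Psi (rev u).
Proof.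
move=> mu su; have : Psi u != [::].
  by rewrite -size_eq0 size_mkseq; case: mu => _; case: height.
rewrite /Gamma_d; case E: (Psi u) => [//|a s] _; rewrite -E.
have [mv sv ev] := epsilon_spec (inhabits [::])
  (fun v => [/\ minimal v, double_rooted v & Psi v = Psi u]) (ex_intro _ u (And3 mu su erefl)).
by congr (Psi (rev _)); apply: minimal_Psi_inj ev => //; rewrite (eqP su) (eqP sv).
Qed.

(** * Frontiers up to a fixed level and the action of [Theta] *)

(** The level is a parameter independent of the height, which allows induction on levels inside one
    word. *)
Definition frontier_prefix i w := mkseq (frontier_letter w) i.+1.

Lemma Psi_frontier_prefix i w : height w = i.+1 -> Psi w = frontier_prefix i w.
Proof. by rewrite /Psi => ->. Qed.

Lemma frontier_prefix_catr i m B : Cinf (m ++ B) -> iter i D m != [::] -> frontier_prefix i (m ++ B) = frontier_prefix i m.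
Proof.
move=> cw m0; apply: (@eq_from_nth _ 0); rewrite !size_mkseq // => j ji.
by rewrite !nth_mkseq // (frontier_letter_catr cw m0).
Qed.

Lemma frontier_prefixS i w : frontier_prefix i.+1 w = rcons (frontier_prefix i w) (frontier_letter w i.+1).
Proof. by rewrite /frontier_prefix /mkseq -[in iota 0 i.+2]addn1 iotaD map_cat cats1. Qed.

Lemma over_Sigma_head w : over_Sigma w -> w != [::] -> nth 0 w 0 = 1 \/ nth 0 w 0 = 2.
Proof. by case: w => // x t; rewrite over_Sigma_cons => /andP[/orP[]/eqP-> _] _; auto. Qed.

Lemma over_Sigma_frontier_prefix i w : Cinf w -> iter i D w != [::] -> ltight i w -> over_Sigma (frontier_prefix i w).
Proof.
move=> cw w0 tw; apply/(all_nthP 0) => j; rewrite size_mkseq => ji.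
rewrite nth_mkseq // (frontier_letter_tight cw w0 tw) // !inE.
have [o _] := Cinf_iter j cw.
by have [->|->] := over_Sigma_head o (@iter_D_neq0 j i _ ji w0).
Qed.

Lemma ltight_minimal i u : Cinf u -> iter i D u != [::] -> iter i.+1 D u = [::] ->
  ltight i u -> ltight i (rev u) -> minimal u.
Proof.
move=> cu n z t r; apply/(minimalP cu (height_eq n z)); split=> //.
Qed.

(* Cut [A ++ t] to the double-rooted minimal prefix [A ++ q] above the letters
   [x; y], where [q] is the single-rooted minimal prefix of [t] above [y]: [Gamma_d]
   reads the right frontier of [A ++ q], which is that of [q], and [Gamma_s] turns
   it into the left frontier of [q], which is that of [t]. *)
Lemma Theta_frontier_prefix i A t x y r : Cinf (A ++ t) -> ltight i (A ++ t) -> ltight i t ->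
  iter i D (A ++ t) = x :: y :: r -> iter i D t = y :: r -> x != y ->
  Theta (frontier_prefix i (A ++ t)) = frontier_prefix i t.
Proof.
move=> cs ts tt Es Et xy; have ct := Cinf_cat cs.
have [q [B [Eq Eqy tq]]] := lift_prefix ct (Et : _ = [:: y] ++ r) isT.
have cp : Cinf (A ++ q) by move: cs; rewrite Eq catA => /Cinf_catr.
have cq := Cinf_cat cp.
have q0 : iter i D q != [::] by rewrite Eqy.
have [X EX] := iter_D_cat i cp.
(* By modularity [X] is unchanged when [B] is put back, and there the whole derivative is
   [x :: y :: r]. *)
have {}EX : iter i D (A ++ q) = [:: x; y].
  rewrite EX Eqy (_ : X = [:: x]) //; apply: (@cat_injr _ (y :: r)).
  by rewrite -[RHS]Es -Et Eq -(@iter_D_modular _ A q) // -Eq.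
have p0 : iter i D (A ++ q) != [::] by rewrite EX.
(* As [x] and [y] differ, both runs have length 1 and are deleted. *)
have pz : iter i.+1 D (A ++ q) = [::].
  by rewrite iterS EX /D /= eq_sym (inj_eq Some_inj) (negPf xy).
have tp : ltight i (A ++ q) by apply/(@ltight_catr _ _ B); rewrite -?catA -?Eq.
have tq' : ltight i q by apply/(@ltight_catr _ _ B); rewrite -?Eq.
have rq0 : iter i D (rev q) != [::] by rewrite iter_D_rev Eqy.
have rqz : iter i.+1 D (rev q) = [::] by rewrite iter_D_rev iterS Eqy.
have rp : rev (A ++ q) = rev q ++ rev A by rewrite rev_cat.
have crp := Cinf_rev cp; have hp := height_eq p0 pz; have hrq := height_eq rq0 rqz.
have trp : ltight i (rev (A ++ q)) by rewrite rp; apply/(ltight_catr _ rq0); rewrite -?rp.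
have mp := ltight_minimal cp p0 pz tp trp.
have mrq : minimal (rev q).
  by apply: ltight_minimal rq0 rqz _ _; rewrite ?revK //; apply: Cinf_rev.
have dp : double_rooted (A ++ q).
  by rewrite /double_rooted; have [_ _ ->] := iter_height hp; rewrite EX.
have sq : single_rooted (rev q).
  by rewrite /single_rooted; have [_ _ ->] := iter_height hrq; rewrite iter_D_rev Eqy.
have Fs : frontier_prefix i (A ++ t) = Psi (A ++ q).
  by rewrite (Psi_frontier_prefix hp) Eq catA frontier_prefix_catr // -catA -Eq.
have Frq : Psi (rev (A ++ q)) = Psi (rev q).
  by rewrite (@Psi_frontier_prefix i) ?height_rev // (Psi_frontier_prefix hrq) rp frontier_prefix_catr // -rp.
have hq : height q = i.+1 by rewrite -height_rev.
rewrite /Theta Fs Gamma_d_Psi // Frq Gamma_s_Psi // revK (Psi_frontier_prefix hq).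
by rewrite Eq frontier_prefix_catr // -Eq.
Qed.

(** * Paths in the graph *)

Lemma G_edge_fun U a V1 V2 : G_edge U a V1 -> G_edge U a V2 -> V1 = V2.
Proof. by case=> {}U _ e; inversion e. Qed.

Lemma G_path_fun U l V1 V2 : G_path U l V1 -> G_path U l V2 -> V1 = V2.
Proof.
move=> p; elim: p V2 => {U l V1} [U _|U a W l V e _ IH] V2 p2; inversion p2; subst=> //.
by apply: IH; rewrite (G_edge_fun e H2).
Qed.

Lemma tight_cat_nil X v : differentiable (X ++ v) -> tight (X ++ v) ->
  D v = D (X ++ v) -> X = [::].
Proof.
case: X => // x X dp tp; have [c ->] := tight_behead dp tp.
have [_ [Y ->]] := D_cat (differentiable_behead dp).
by move/(congr1 size); rewrite /= size_cat; lia.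
Qed.

Lemma G_path_rcons U l V a W :
  G_path U l V -> G_edge V a W -> over_Sigma W -> G_path U (rcons l a) W.
Proof.
move=> p e oW; elim: p e => {U l V} [U oU|U b V l V' eb _ IH] eW.
  by apply: G_path_cons eW _; apply: G_path_nil.
by apply: G_path_cons eb _; apply: IH.
Qed.

Lemma G_path_frontier_prefix i A s : Cinf (A ++ s) -> iter i D s = iter i D (A ++ s) ->
  iter i D s != [::] -> ltight i s -> G_path [::] (frontier_prefix i (A ++ s)) (frontier_prefix i s).
Proof.
elim: i A s => [|i IHi] A s cw Es s0 ts; have cs := Cinf_cat cw.
  rewrite -(cat_injr (Es : [::] ++ s = _)) /frontier_prefix /=; move: cs s0 => [os _] s0.
  have [e|e] := over_Sigma_head os s0; rewrite /mkseq /= e.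
    by apply: G_path_cons (@G_edge1 [::] isT) _; apply: G_path_nil.
  by apply: G_path_cons (@G_edge2 [::] isT) _; apply: G_path_nil.
have w0 : iter i.+1 D (A ++ s) != [::] by rewrite -Es.
have p0 : iter i D (A ++ s) != [::] by apply: iter_D_neq0 w0.
(* The induction hypothesis applies to [t], the shortest suffix above the whole level [i]. The last
   edge must lead from its frontier to that of [s]. *)
have [A' [t [e Et tt]]] := lift_suffix cw (erefl : iter i D (A ++ s) = [::] ++ _) p0.
have t0 : iter i D t != [::] by rewrite Et.
have ct : Cinf t by move: cw; rewrite e => /Cinf_cat.
have IH : G_path [::] (frontier_prefix i (A ++ s)) (frontier_prefix i t).
  by rewrite e; apply: IHi; rewrite -?e.
have [tsi tsp] := iffLR (ltightS i s) ts.
have oFs := over_Sigma_frontier_prefix cs s0 ts; have oFt := over_Sigma_frontier_prefix ct t0 tt.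
have [X EX] := iter_D_cat i cw.
have dp : differentiable (iter i D (A ++ s)) by case: cw.
have Fs : frontier_letter s i.+1 = nth 0 (iter i.+1 D s) 0.
  by rewrite frontier_letterS ?tsp.
rewrite frontier_prefixS; apply: G_path_rcons IH _ oFs; rewrite frontier_prefixS frontier_letterS // Fs -Es.
have [tp|ntp] := boolP (tight (iter i D (A ++ s))).
  (* At a tight level [s] and [t] have the same [i]-th derivative, so they coincide and the edge
     appends a letter 1 or 2. *)
  have X0 : X = [::] by apply: (@tight_cat_nil _ (iter i D s)); rewrite -EX // -!iterS.
  rewrite X0 in EX.
  have -> : s = t by apply: ltight_uniq e cw tsi tt _; rewrite Et EX.
  have oD : over_Sigma (iter i.+1 D t) by have [] := Cinf_iter i.+1 ct.
  have nD : iter i.+1 D t != [::] by rewrite iterS Et -iterS.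
  have [->|->] := over_Sigma_head oD nD.
    exact: G_edge1.
  exact: G_edge2.
(* Otherwise [X] is a single letter: it is nonempty because [s] is tight at level [i], and what
   follows its first letter is tight with the right derivative already. *)
have [E1 hd Eb tb] := not_tightP dp w0 ntp.
case: X EX => [|x X] EX; first by rewrite EX tsp in ntp.
rewrite EX [behead _]/= in hd Eb tb dp.
have X0 : X = [::].
  apply: (@tight_cat_nil _ (iter i D s)) => //; first exact: differentiable_behead dp.
  by rewrite Eb -EX -!iterS.
rewrite X0 in EX hd.
case Ev: (iter i D s) hd => [|y r] xy; first by rewrite iterS Ev in s0.
(* By monotonicity [s] is a suffix of [t], which provides the prefix [E] for
   [Theta_frontier_prefix]. *)
have le : size s <= size t.
  by apply: (ltight_size e cw tsi); rewrite Et EX size_cat leq_addl.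
have [E EtE] := eq_cat_suffix (esym e) le.
rewrite Es iterS E1 -(@Theta_frontier_prefix i E s x y r) -?EtE //.
- exact: G_edge0.
- by rewrite Et EX Ev.
- by rewrite eq_sym; exact: xy.
Qed.

(** * The minimal part and the conclusion *)

Lemma size_D_nil w : D w = [::] -> size w <= 2.
Proof.
move=> e; have := Delta_D_nil e; move: e; rewrite /D => + eD; rewrite {}eD.
by case: (size w) => [|[|[|n]]] //=; rewrite -[1 :: 1 :: _]/(nseq n.+2 1) rev_nseq /=
  -[1 :: _]/(nseq n.+1 1) rev_nseq.
Qed.

Lemma ltight_of_minimal i u : minimal u -> height u = i.+1 ->
  ltight i u /\ ltight i (rev u).
Proof. by move=> mu hu; have [cu _ _] := mu; apply/(minimalP cu hu). Qed.

(* [s] lifts the root of [w] to the left end, so no minimal factor of full height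
   starts before [s]. *)
Lemma minimal_factor_first i A s u0 B w : w = A ++ s -> s = u0 ++ B -> Cinf w ->
  height w = i.+1 -> iter i D s = iter i D w ->
  minimal u0 -> single_rooted u0 -> height u0 = i.+1 ->
  forall u, minimal_part w u <-> u = u0.
Proof.
move=> ew es cw hw Es mu0 su0 hu0.
have [n0 _ _] := iter_height hu0; have [t0 _] := ltight_of_minimal mu0 hu0.
have cs : Cinf s by move: cw; rewrite ew => /Cinf_cat.
have first k u : minimal_factor_at w k u ->
    size A <= k /\ (k = size A -> u = u0).
  case=> /prefixP[B' e] mu su; rewrite hw => hu.
  have [n _ _] := iter_height hu; have [tu _] := ltight_of_minimal mu hu.
  have kw : k <= size w.
    rewrite leqNgt; apply/negP => /ltnW kw; move: e; rewrite drop_oversize //.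
    by case: u n {mu su hu tu} => //; rewrite iter_D_nil.
  have ew' : take k w ++ drop k w = A ++ s by rewrite cat_take_drop.
  have cw' : Cinf (take k w ++ drop k w) by rewrite cat_take_drop.
  have cd : Cinf (drop k w) := Cinf_cat cw'.
  have td : ltight i (drop k w) by rewrite e; apply/(ltight_catr _ n); rewrite -?e.
  (* The suffix starting at a candidate is [ltight], and its [i]-th derivative is a suffix of the
     root of [w], which is that of [s]. *)
  have le : size (drop k w) <= size s.
    apply: (ltight_size ew' cw' td); rewrite Es.
    by have [X] := iter_D_cat i cw'; rewrite cat_take_drop => ->; rewrite size_cat leq_addl.
  split; first by move: le; rewrite size_drop {1}ew size_cat; move: kw; rewrite ew size_cat; lia.
  move=> kA; have {}e : s = u ++ B' by rewrite -e kA ew drop_size_cat.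
  apply: minimal_Psi_inj => //; first by rewrite (eqP su) (eqP su0).
  rewrite (Psi_frontier_prefix hu) (Psi_frontier_prefix hu0) -(@frontier_prefix_catr i u B') -?e //.
  by rewrite es frontier_prefix_catr // -es.
have at0 : minimal_factor_at w (size A) u0.
  by split; rewrite ?hu0 ?hw // ew drop_size_cat // es prefix_prefix.
move=> u; split=> [[k ku kmin]|->]; last by exists (size A) => // k u' /first[].
have [Ak] := first k u ku; apply; apply/eqP; rewrite eqn_leq Ak andbT.
exact: kmin at0.
Qed.

Theorem theorem6 (U u : seq nat) (hU : over_Sigma U)
    (hmin : minimal u) (hsingle : single_rooted u) (hfront : Psi u = U)
    (w : seq nat) (hw : Cinf w) (U0 V0 : seq nat)
    (hvert : vertical_representation w = (U0, V0)) :
  minimal_part w u <->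
  G_path [::] U0 U /\
  ((single_rooted w /\ G_path [::] V0 (Gamma_s U)) \/
   (double_rooted w /\ G_path [::] V0 (Gamma_d U))).
Proof.
case: hvert => <- <-; rewrite -{}hfront {U hU}.
case h: (height w) => [|i].
  have w0 : iter 0 D w = [::].
    by apply/eqP; apply: contraFT (ltnn 0) => /heightP; rewrite h.
  split=> [[k [_ _ _ e]]|[_]]; first by case: hmin => _; rewrite e h.
  by rewrite /single_rooted /double_rooted /Defs.root h (w0 : iter 0.-1 D w = _); case=> [] [].
have [r0 rz rE] := iter_height h.
have [A [s [ew Es ts]]] := lift_suffix hw (erefl : iter i D w = [::] ++ _) r0.
have cs : Cinf s by move: hw; rewrite ew => /Cinf_cat.
have s0 : iter i D s != [::] by rewrite Es.
(* Cutting [s] on the right as well gives a minimal word [p] with the root of [w]. *)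
have [p [B [es Ep trp]]] := lift_prefix cs (esym (cats0 (iter i D s))) s0.
have cp : Cinf p by move: cs; rewrite es => /Cinf_catr.
have p0 : iter i D p != [::] by rewrite Ep.
have pz : iter i.+1 D p = [::] by rewrite iterS Ep Es -iterS.
have tp : ltight i p by apply/(@ltight_catr _ _ B); rewrite -?es.
have mp := ltight_minimal cp p0 pz tp trp; have hp := height_eq p0 pz.
have [c [r Ecr]] : exists c r, iter i D p = [:: c] ++ r.
  by case: (iter i D p) p0 => // c r _; exists c, r.
(* Above the first letter [c] of the root lies [v], the future minimal part; as a prefix of [p] of
   the same height, it shares its left frontier. *)
have [v [B' [ep Ev trv]]] := lift_prefix cp Ecr isT.
have cv : Cinf v by move: cp; rewrite ep => /Cinf_catr.
have v0 : iter i D v != [::] by rewrite Ev.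
have vz : iter i.+1 D v = [::] by rewrite iterS Ev.
have tv : ltight i v by apply/(@ltight_catr _ _ B'); rewrite -?ep.
have mv := ltight_minimal cv v0 vz tv trv; have hv := height_eq v0 vz.
have sv : single_rooted v.
  by rewrite /single_rooted; have [_ _ ->] := iter_height hv; rewrite Ev.
have ev : s = v ++ (B' ++ B) by rewrite catA -ep.
have Ppv : Psi p = Psi v.
  by rewrite (Psi_frontier_prefix hp) (Psi_frontier_prefix hv) {1}ep frontier_prefix_catr // -ep.
have left_path : G_path [::] (Psi w) (Psi v).
  rewrite (Psi_frontier_prefix h) -Ppv (Psi_frontier_prefix hp) -(@frontier_prefix_catr i p B) // -?es // ew.
  by apply: G_path_frontier_prefix; rewrite -?ew.
(* Seen from the right, the shortest suffix above the root is [rev (A ++ p)], whose frontier is that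
   of its prefix [rev p]. *)
have right_path : G_path [::] (Psi (rev w)) (Psi (rev p)).
  have cAp : Cinf (A ++ p) by move: hw; rewrite ew es catA => /Cinf_catr.
  have EAp : iter i D (A ++ p) = iter i D w.
    have [X EX] := iter_D_cat i cAp.
    have := @iter_D_modular i A p B X; rewrite -es -ew => /(_ hw p0 EX).
    by rewrite Es => /(cat_injr (s1 := [::])) eX; rewrite EX -eX Ep Es.
  have ewr : rev w = rev B ++ (rev p ++ rev A) by rewrite ew es !rev_cat catA.
  have rp0 : iter i D (rev p) != [::].
    by rewrite iter_D_rev -size_eq0 size_rev size_eq0.
  have crp : Cinf (rev p ++ rev A) by rewrite -rev_cat; apply: Cinf_rev.
  rewrite (@Psi_frontier_prefix i (rev w)) ?height_rev // (@Psi_frontier_prefix i (rev p)) ?height_rev //.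
  rewrite -(@frontier_prefix_catr i (rev p) (rev A)) // ewr.
  apply: G_path_frontier_prefix; rewrite -?ewr; first exact: Cinf_rev.
  - by rewrite -rev_cat !iter_D_rev EAp.
  - by rewrite -rev_cat iter_D_rev EAp -size_eq0 size_rev size_eq0.
  - by apply/(ltight_catr _ rp0).
have rootp : Defs.root p = Defs.root w.
  by have [_ _ ->] := iter_height hp; rewrite rE Ep Es.
rewrite (minimal_factor_first ew ev hw h Es mv sv hv); split=> [->|[pU _]].
  (* The root of [w] has one or two letters. In both cases [p] has that root and the left frontier
     of [v], so [Gamma_s] or [Gamma_d] returns the frontier of [rev p]. *)
  split=> //; rewrite -Ppv; have := size_D_nil (etrans (esym (iterS _ _ _)) rz).
  rewrite -rE; case E: (size (Defs.root w)) => [|[|[|]]] // _.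
  - by move: E; rewrite rE => /size0nil E; rewrite E in r0.
  - left; rewrite /single_rooted E; split=> //.
    by rewrite Gamma_s_Psi // /single_rooted rootp E.
  - right; rewrite /double_rooted E; split=> //.
    by rewrite Gamma_d_Psi // /double_rooted rootp E.
(* The graph is deterministic, so the label [Psi w] leads to one vertex only, and [u] and [v] share
   their left frontier. *)
apply: minimal_Psi_inj => //; first by rewrite (eqP hsingle) (eqP sv).
exact: G_path_fun pU left_path.
Qed.
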